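(* For any prime $p\geq 5$ and any positive integers $k$ and $r$ we have $$E_{rp^{k-1}(p-1)} \equiv E_{p-1}^{rp^{k-1}} \pmod{p^{k+1}}.$$
   Context: For even $w\ge 2$, let $B_w$ be the $w$-th Bernoulli number, $\sigma_{w-1}(n)=\sum_{d\mid n} d^{w-1}$, and define (as a formal power series in $q$) the Eisenstein series of weight $w$ by $E_w := 1-\frac{2w}{B_w}\sum_{n\ge 1}\sigma_{w-1}(n)q^n$. Let $\mathbb{Z}_{(p)}$ be the ring of $p$-integral rational numbers. The congruence $\sum a(n)q^n\equiv\sum b(n)q^n \pmod{p^m}$ means $a(n)\equiv b(n)\pmod{p^m}$ for all $n$ (i.e. $a(n)-b(n)\in p^m\mathbb{Z}_{(p)}$). *)

(* Defs.v *)
From mathcomp Require Import all_boot all_order all_algebra.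

Set Implicit Arguments.
Unset Strict Implicit.
Unset Printing Implicit Defensive.

Import Order.TTheory GRing.Theory Num.Theory.
Local Open Scope ring_scope.

(* [:: B_0; ...; B_(n-1)], each entry being obtained from the previous ones by
   solving sum_(k <= m) C(m + 1, k) B_k = [m = 0] for B_m
   (the convention with B_1 = -1/2). *)
Fixpoint bernoulli_seq (n : nat) : seq rat :=
  if n is m.+1 then
    let s := bernoulli_seq m in
    rcons s (((m == 0%N)%:R - \sum_(k < m) 'C(m.+1, k)%:R * s`_k) / m.+1%:R)
  else [::].

Definition bernoulli (n : nat) : rat := (bernoulli_seq n.+1)`_n.

Lemma size_bernoulli_seq n : size (bernoulli_seq n) = n.
Proof. by elim: n => //= n IHn; rewrite size_rcons IHn. Qed.

Lemma nth_bernoulli_seq n k : (k < n)%N -> (bernoulli_seq n)`_k = bernoulli k.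
Proof.
elim: n => // n IHn; rewrite ltnS leq_eqVlt => /predU1P[-> // | lt_kn] /=.
by rewrite nth_rcons size_bernoulli_seq lt_kn IHn.
Qed.

Lemma bernoulli_rec m :
  \sum_(k < m.+1) 'C(m.+1, k)%:R * bernoulli k = (m == 0%N)%:R.
Proof.
rewrite big_ord_recr /= {2}/bernoulli /= nth_rcons size_bernoulli_seq ltnn eqxx.
rewrite -[X in 'C(X, m)]addn1 addnC binSn mulrCA divff ?pnatr_eq0 // mulr1.
under [X in _ - X]eq_bigr => k _ do rewrite nth_bernoulli_seq //.
by rewrite addrC subrK.
Qed.

Definition sigma (s n : nat) : nat := \sum_(d <- divisors n) d ^ s.

(* A formal power series in q over the rationals is its coefficient sequence:
   [a] stands for sum_n (a n) q^n. *)
Definition qseries := nat -> rat.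

Definition qseries_one : qseries := fun n => (n == 0%N)%:R.

Definition qseries_mul (a b : qseries) : qseries :=
  fun n => \sum_(i < n.+1) a i * b (n - i)%N.

Definition qseries_exp (a : qseries) (m : nat) : qseries :=
  iter m (qseries_mul a) qseries_one.

(* Meaningful for even w >= 2. *)
Definition eisenstein (w : nat) : qseries :=
  fun n => if n == 0%N then 1
           else - ((2 * w)%:R / bernoulli w) * (sigma w.-1 n)%:R.

(* Membership in Z_(p), for p prime. *)
Definition p_integral (p : nat) (x : rat) : bool := ~~ (p%:Z %| denq x)%Z.

Definition rat_congr (p m : nat) (x y : rat) : Prop :=
  exists2 z : rat, p_integral p z & x - y = (p ^ m)%:R * z.

Definition qseries_congr (p m : nat) (a b : qseries) : Prop :=
  forall n : nat, rat_congr p m (a n) (b n).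

(* Main.v *)
(* Write N = r p^(k-1).  Faulhaber's formula and Fermat's little theorem give
   p B_w = -1 mod p whenever p - 1 divides w > 0.  Hence E_(p-1) = 1 + p f with f
   p-integral, and the binomial expansion of (1 + p f)^N reduces to 1 + p N f
   modulo p^(k+1).  The factor w = N (p - 1) of the Eisenstein coefficients already
   contributes p^k to E_w - 1 = p N (...), so it only remains to compare
   sigma_(w-1)(n) / (p B_w) with sigma_(p-2)(n) / (p B_(p-1)) modulo p, where
   p B_w = p B_(p-1) = -1 and Fermat's little theorem identifies the sigmas. *)
Require Import Defs.
From HB Require Import structures.
From mathcomp Require Import all_boot all_order all_algebra.
From mathcomp Require Import cyclic ring zify.
Import Order.TTheory GRing.Theory Num.Theory.

Local Open Scope ring_scope.

(** * The ring of p-integral rationals *)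

(* Unlike [p_integral p], this is a subring for every [p], prime or not, so that it
   can be registered as such and the [rpred] lemmas apply without side condition. *)
Definition coprime_den (p : nat) : {pred rat} := fun x => coprime p `|denq x|%N.

(** Any fraction with denominator prime to [p] certifies membership, so closure under ring
    operations needs no reduction to lowest terms. *)
Lemma coprime_denP (p : nat) (x : rat) :
  reflect (exists b c : int, [/\ coprime p `|b|%N, b != 0 & x * b%:~R = c%:~R])
          (x \in coprime_den p).
Proof.
apply: (iffP idP) => [xp | [b [c [pb b0 xb]]]].
  exists (denq x), (numq x); split; [exact: xp | exact: denq_neq0 |].
  by rewrite -{1}[x]divq_num_den divfK // intr_eq0 denq_neq0.
have : numq x * b = c * denq x.
  apply: (@intr_inj rat).
  rewrite !rmorphM /= -xb -{2}[x]divq_num_den mulrAC divfK //.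
  by rewrite intr_eq0 denq_neq0.
move=> /(congr1 absz); rewrite !abszM => e.
rewrite /coprime_den unfold_in; apply: coprime_dvdr pb.
rewrite -(@Gauss_dvdr _ `|numq x|%N) ?e ?dvdn_mull //.
by rewrite coprime_sym coprime_num_den.
Qed.

Lemma coprime_den_subring_closed (p : nat) : subring_closed (coprime_den p).
Proof.
split=> [|x y|x y]; first by rewrite unfold_in /coprime_den coprimen1.
- move=> /coprime_denP[b [c [pb b0 xb]]] /coprime_denP[d [e [pd d0 yd]]].
  apply/coprime_denP; exists (b * d), (c * d - e * b).
  rewrite abszM coprimeMr pb pd mulf_neq0 //; split=> //.
  by rewrite rmorphB !rmorphM /= -xb -yd; ring.
move=> /coprime_denP[b [c [pb b0 xb]]] /coprime_denP[d [e [pd d0 yd]]].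
apply/coprime_denP; exists (b * d), (c * e).
rewrite abszM coprimeMr pb pd mulf_neq0 //; split=> //.
by rewrite !rmorphM /= -xb -yd; ring.
Qed.

HB.instance Definition _ (p : nat) :=
  GRing.isSubringClosed.Build rat (coprime_den p) (coprime_den_subring_closed p).

Lemma coprime_den_p_integral (p : nat) (x : rat) :
  prime p -> (x \in coprime_den p) = p_integral p x.
Proof. by move=> pp; rewrite unfold_in /coprime_den prime_coprime. Qed.

(** With z = c/b one gets x = (p c - b)/b, whose numerator is prime to [p]; so x is a unit, and 1/x
    + 1 = (x + 1)/x. *)
Lemma invr_congr_N1 (p : nat) (x z : rat) :
  (1 < p)%N -> z \in coprime_den p -> x + 1 = p%:R * z ->
  [/\ x != 0, x^-1 \in coprime_den p
    & exists2 y, y \in coprime_den p & x^-1 + 1 = p%:R * y].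
Proof.
move=> p1 zp xz.
have [b [c [pb b0 zb]]] := coprime_denP _ _ zp.
pose d : int := p%:Z * c - b.
have xd : x * b%:~R = d%:~R.
  by rewrite /d rmorphB rmorphM /= -zb mulrA -[(Posz p)%:~R]/(p%:R : rat) -xz; ring.
have pd : coprime p `|d|%N.
  rewrite /coprime -[p in gcdn p _]/(`|p%:Z|%N) -[gcdn _ _]/(`|gcdz p d|%N).
  by rewrite /d mulrC gcdzMDl gcdzN.
have d0 : d != 0.
  by apply: contraTneq pd => ->; rewrite /coprime gcdn0 gtn_eqF.
have x0 : x != 0.
  apply: contraNneq d0 => x0; move/esym/eqP: xd.
  by rewrite x0 mul0r intr_eq0.
have xVp : x^-1 \in coprime_den p.
  by apply/coprime_denP; exists d, b; split; rewrite // -xd mulrA mulVf ?mul1r.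
split=> //; exists (z * x^-1); first exact: rpredM.
by rewrite mulrA -xz mulrDl mulfV // mul1r addrC.
Qed.

(** * p-adic estimates *)

(** If v = [logn p j] is positive, then j >= p^v >= 3^v >= v + 2. For p = 2 this fails at j = 2. *)
Lemma logn_add2_leq (p j : nat) : (2 < p)%N -> (1 < j)%N -> (logn p j + 2 <= j)%N.
Proof.
move=> p2 j1.
have [-> //|v0] := posnP (logn p j).
have := dvdn_leq (ltnW j1) (pfactor_dvdnn p j).
apply: leq_trans; case: (logn p j) v0 => // v _.
elim: v => [|v IH]; first by rewrite expn1.
rewrite expnS (leq_trans _ (leq_mul (ltnW p2) IH)) //; lia.
Qed.

(** Writing j = u p^v with u prime to [p], the quotient is p^(j-2-v)/u. *)
Lemma coprime_den_expr_div (p j : nat) :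
  prime p -> (2 < p)%N -> (1 < j)%N -> p%:R ^+ (j - 2) / j%:R \in coprime_den p.
Proof.
move=> pp p2 j1.
have j0 := ltnW j1; have [u pu ej] := pfactor_coprime pp j0.
have u0 : (0 < u)%N by move: j0; rewrite {1}ej muln_gt0 => /andP[].
have := logn_add2_leq _ _ p2 j1; set v := logn p j in ej * => vj.
apply/coprime_denP; exists u%:Z, (p ^ (j - 2 - v))%:Z.
split=> //; first by rewrite -lt0n.
have p0 : (p%:R : rat) != 0 by rewrite pnatr_eq0 -lt0n prime_gt0.
have uN0 : (u%:R : rat) != 0 by rewrite pnatr_eq0 -lt0n.
rewrite -!pmulrn natrX (_ : j - 2 = (j - 2 - v) + v)%N; last lia.
rewrite exprD addnK ej natrM natrX; field.
by rewrite uN0 expf_neq0.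
Qed.

(** * Bernoulli polynomials and Faulhaber's formula *)

Definition bernoulli_poly (m : nat) (x : rat) : rat :=
  \sum_(k < m.+1) 'C(m, k)%:R * bernoulli k * x ^+ (m - k).

(** Both sides count ordered pairs of disjoint subsets of sizes [k] and [j]. *)
Lemma mul_bin_subC (n k j : nat) :
  ('C(n, k) * 'C(n - k, j) = 'C(n, j) * 'C(n - j, k))%N.
Proof.
have bin0 a b : (n < a + b)%N -> ('C(n, a) * 'C(n - a, b) = 0)%N.
  case: (ltnP n a) => na nab; first by rewrite bin_small.
  by rewrite [X in (_ * X)%N]bin_small ?muln0 //; lia.
have [kjn|kjn] := leqP (k + j) n; last by rewrite !bin0 // addnC.
have a : (k <= n)%N by lia.
have b : (j <= n - k)%N by lia.
have c : (j <= n)%N by lia.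
have d : (k <= n - j)%N by lia.
have := bin_fact c; rewrite -(bin_fact d) -{1}(bin_fact a) -(bin_fact b).
have -> : (n - j - k = n - k - j)%N by lia.
have := fact_gt0 k; have := fact_gt0 j; have := fact_gt0 (n - k - j).
move: (_`!) (j`!) (k`!) => A B C A0 B0 C0 e.
apply/eqP; rewrite -(@eqn_pmul2r (A * (B * C))) ?muln_gt0 ?A0 ?B0 //.
by apply/eqP; lia.
Qed.

(** Gives inner sums of varying length a common range, so that double sums can be exchanged. *)
Lemma sum_binomial_widen (n m : nat) (F : nat -> rat) : (n <= m)%N ->
  \sum_(k < n.+1) 'C(n, k)%:R * F k = \sum_(k < m.+1) 'C(n, k)%:R * F k.
Proof.
move=> nm; rewrite (big_ord_widen m.+1 (fun k => 'C(n, k)%:R * F k)) ?ltnS //.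
rewrite [RHS](bigID (fun k : 'I_m.+1 => (k < n.+1)%N)) /= [X in _ + X]big1 ?addr0 //.
by move=> k kn; rewrite bin_small ?mul0r // -ltnS ltnNge ltnS -ltnS; lia.
Qed.

Lemma sum_bin_bernoulli (n m : nat) : (n <= m)%N ->
  \sum_(k < m.+1) 'C(n, k)%:R * bernoulli k = bernoulli n + (n == 1%N)%:R.
Proof.
move=> /sum_binomial_widen <-; case: n => [|n].
  by rewrite big_ord1 bin0 mul1r addr0.
by rewrite big_ord_recr /= bernoulli_rec binn mul1r addrC.
Qed.

Lemma bernoulli_polyD1 (m : nat) (x : rat) :
  bernoulli_poly m.+1 (x + 1) = bernoulli_poly m.+1 x + m.+1%:R * x ^+ m.
Proof.
rewrite /bernoulli_poly; set n := m.+1.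
(* Expanding (x + 1)^(n - k) and collecting powers of x, the coefficient of x^j
   contains the defining Bernoulli sum of length n - j. *)
transitivity (\sum_(j < n.+1) 'C(n, j)%:R * x ^+ j *
   (\sum_(k < n.+1) 'C(n - j, k)%:R * bernoulli k)).
  under [RHS]eq_bigr => j _ do rewrite mulr_sumr.
  rewrite exchange_big /=; apply: eq_bigr => k _.
  rewrite [x + 1]addrC exprDn.
  under [X in _ * X = _]eq_bigr => j _ do rewrite expr1n mul1r -mulr_natl.
  rewrite (sum_binomial_widen _ _ (fun j => x ^+ j) (leq_subr k n)) mulr_sumr.
  apply: eq_bigr => j _.
  have /(congr1 (fun i => i%:R : rat)) := mul_bin_subC n k j.
  rewrite !natrM => e.
  transitivity ('C(n, k)%:R * 'C(n - k, j)%:R * (bernoulli k * x ^+ j)); first ring.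
  by rewrite e; ring.
(* The inner sum is B_(n-j) + [n - j = 1]: the first parts reassemble the polynomial under j -> n -
   j, the bracket survives only at j = m. *)
under eq_bigr => j _ do rewrite sum_bin_bernoulli ?leq_subr // mulrDr.
rewrite big_split /=; congr (_ + _).
  rewrite (reindex_inj rev_ord_inj) /=; apply: eq_bigr => k _.
  have kn : (k <= n)%N by rewrite -ltnS.
  by rewrite subSS bin_sub // subKn // mulrAC.
rewrite (bigD1 (inord m)) //= inordK /n; last lia.
rewrite subSnn eqxx mulr1 big1 ?addr0 ?binSn // => j jm.
case: eqP => e; last by rewrite mulr0.
by case/eqP: jm; apply: val_inj; rewrite /= inordK; have := ltn_ord j; rewrite /n in e *; lia.
Qed.

Lemma power_sum_bernoulli (w n : nat) :
  w.+1%:R * \sum_(a < n) a%:R ^+ w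
    = \sum_(k < w.+1) 'C(w.+1, k)%:R * bernoulli k * n%:R ^+ (w.+1 - k) :> rat.
Proof.
(* The missing term k = w + 1 completes the right-hand side to B_(w+1)(n), which telescopes in n. *)
apply: (@addIr _ (bernoulli w.+1)).
transitivity (bernoulli_poly w.+1 n%:R); last first.
  by rewrite /bernoulli_poly [LHS]big_ord_recr /= subnn binn mul1r mulr1.
elim: n => [|n IH].
  rewrite big_ord0 mulr0 add0r /bernoulli_poly big_ord_recr /= subnn binn mul1r.
  rewrite mulr1 big1 ?add0r // => k _.
  by rewrite expr0n subn_eq0 leqNgt ltn_ord /= mulr0.
by rewrite big_ord_recr /= -[n.+1%:R]natr1 bernoulli_polyD1 -IH; ring.
Qed.

(** * The residue of p B_w modulo p *)

(** Divide Faulhaber's formula at n = p by w + 1. With j = w + 1 - k >= 2, each term k < w becomes p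
    C(w,k) (p^(j-2)/j) (p B_k), where p B_k is p-integral by strong induction. *)
Lemma bernoulli_congr_power_sum (p w : nat) : prime p -> (2 < p)%N ->
  exists2 z, z \in coprime_den p
    & p%:R * bernoulli w = \sum_(a < p) a%:R ^+ w + p%:R * z.
Proof.
move=> pp p2; elim/ltn_ind: w => w IH.
have pBp k : (k < w)%N -> p%:R * bernoulli k \in coprime_den p.
  move=> /IH[z zp ->]; apply: rpredD; last by rewrite rpredM ?rpred_nat.
  by apply: rpred_sum => a _; rewrite rpredX ?rpred_nat.
exists (- \sum_(k < w) 'C(w, k)%:R * (p%:R ^+ (w.+1 - k - 2) / (w.+1 - k)%:R)
          * (p%:R * bernoulli k)).
  rewrite rpredN; apply: rpred_sum => k _; apply: rpredM; last exact: pBp.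
  apply: rpredM; first exact: rpred_nat.
  by apply: coprime_den_expr_div => //; have := ltn_ord k; lia.
have w0 : (w.+1%:R : rat) != 0 by rewrite pnatr_eq0.
apply: (mulfI w0); rewrite mulrDr power_sum_bernoulli big_ord_recr /=.
rewrite binSn subSnn expr1 mulrN mulrN !mulr_sumr addrAC -sumrB.
rewrite big1 ?add0r => [|k _]; first by ring.
have kw := ltn_ord k.
have j0 : ((w.+1 - k)%:R : rat) != 0 by rewrite pnatr_eq0; lia.
(* This trades the denominator w + 1 for j = w + 1 - k. *)
have e : ((w.+1 - k) * 'C(w.+1, k) = w.+1 * 'C(w, k))%N.
  have kw' := ltnW kw; have kwS := leqW kw'.
  have := bin_fact kwS; rewrite factS -(bin_fact kw') subSn // factS.
  have := fact_gt0 k; have := fact_gt0 (w - k).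
  move: (_`!) (k`!) => A B A0 B0 e.
  apply/eqP; rewrite -(@eqn_pmul2r (A * B)) ?muln_gt0 ?A0 ?B0 //.
  by apply/eqP; lia.
move/(congr1 (fun i => i%:R : rat)): e; rewrite !natrM => e.
have -> : (p%:R : rat) ^+ (w.+1 - k) = p%:R ^+ (w.+1 - k - 2) * p%:R * p%:R.
  by rewrite -!exprSr; congr (_ ^+ _); lia.
have -> : ('C(w.+1, k)%:R : rat) = w.+1%:R * 'C(w, k)%:R / (w.+1 - k)%:R.
  by rewrite -e mulrAC mulfV ?mul1r.
by field.
Qed.

Lemma expn_fermat (p a w : nat) : prime p -> ~~ (p %| a)%N -> (p.-1 %| w)%N ->
  a ^ w = 1 %[mod p].
Proof.
move=> pp pa /dvdnP[c ->]; rewrite mulnC expnM -modnXm.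
rewrite -(totient_prime pp) Euler_exp_totient ?modnXm ?exp1n //.
by rewrite coprime_sym prime_coprime.
Qed.

Lemma sum_expn_fermat (p w : nat) : prime p -> (0 < w)%N -> (p.-1 %| w)%N ->
  (\sum_(a < p) a ^ w = p.-1 %[mod p])%N.
Proof.
move=> pp w0 pw; case: p pp pw => // p pp pw.
(* The term a = 0 vanishes because w > 0; the other p - 1 terms are 1 modulo [p]. *)
rewrite big_ord_recl /= exp0n // add0n -modn_summ.
rewrite (eq_bigr (fun=> 1 %% p.+1)%N) => [|i _]; last first.
  by rewrite expn_fermat // gtnNdvd // ltnS; exact: ltn_ord.
by rewrite modn_summ sum_nat_const card_ord muln1.
Qed.

Lemma eqn_mod_rat (p a b : nat) : (a = b %[mod p])%N ->
  exists2 z, z \in coprime_den p & a%:R - b%:R = p%:R * z :> rat.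
Proof.
move=> ab; exists ((a %/ p)%:R - (b %/ p)%:R); first by rewrite rpredB ?rpred_nat.
rewrite {1}(divn_eq a p) {1}(divn_eq b p) ab !natrD !natrM; ring.
Qed.

(** The von Staudt-Clausen congruence at a prime with p - 1 dividing w: the power sum is p - 1
    modulo [p]. *)
Lemma bernoulli_congr_N1 (p w : nat) :
  prime p -> (2 < p)%N -> (0 < w)%N -> (p.-1 %| w)%N ->
  exists2 z, z \in coprime_den p & p%:R * bernoulli w + 1 = p%:R * z.
Proof.
move=> pp p2 w0 pw; have [y yp ->] := bernoulli_congr_power_sum _ w pp p2.
have [z zp] := eqn_mod_rat _ _ _ (sum_expn_fermat _ _ pp w0 pw).
rewrite natr_sum (eq_bigr _ (fun (a : 'I_p) _ => natrX rat a w)) => e.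
exists (1 + y + z); first by rewrite !rpredD ?rpred1.
move/eqP: e; rewrite subr_eq => /eqP ->.
by rewrite -subn1 natrB ?prime_gt0 //; ring.
Qed.

(** * Divisor sums modulo p *)

Lemma sigma_congr (p N n : nat) : prime p -> (2 < p)%N -> (0 < N)%N ->
  (sigma (N * p.-1).-1 n = sigma p.-1.-1 n %[mod p])%N.
Proof.
move=> pp p2 N0; rewrite /sigma -modn_summ -[RHS]modn_summ.
congr (_ %% _)%N; apply: eq_bigr => d _.
case: N N0 => // N _.
have -> : ((N.+1 * p.-1).-1 = N * p.-1 + p.-1.-1)%N by rewrite mulSn; lia.
(* If p divides d, both powers vanish modulo [p], as p - 2 > 0; otherwise Fermat removes the
   multiple of p - 1. *)
have [pd|pd] := boolP (p %| d)%N.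
  have p_dvd_exp m : (0 < m)%N -> (d ^ m %% p = 0)%N.
    by move=> m0; apply/eqP; rewrite -/(dvdn _ _) (dvdn_trans pd) // dvdn_exp.
  by rewrite !p_dvd_exp //; lia.
by rewrite expnD -modnMml expn_fermat ?dvdn_mull // modnMml mul1n.
Qed.

(** * Binomial expansion of (1 + p f)^N *)

(** From j C(N,j) = N C(N-1,j-1), p^k divides p^v C(N,j) with v = [logn p j]; since j >= v + 2, p^j
    supplies p^v and two more factors. *)
Lemma dvdn_bin_expn (p k N j : nat) : prime p -> (2 < p)%N -> (1 < j)%N ->
  (p ^ k %| N)%N -> (p ^ k.+2 %| 'C(N, j) * p ^ j)%N.
Proof.
move=> pp p2 j1 pN; have j0 := ltnW j1.
have [u pu ej] := pfactor_coprime pp j0.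
have vj := logn_add2_leq _ _ p2 j1.
have : (p ^ k %| u * (p ^ logn p j * 'C(N, j)))%N.
  rewrite mulnA -ej -(prednK j0) -mul_bin_diag; exact: dvdn_mulr.
rewrite Gauss_dvdr ?coprimeXl // => pC.
have -> : (p ^ j = p ^ logn p j * p ^ 2 * p ^ (j - logn p j - 2))%N.
  by rewrite -!expnD; congr (_ ^ _)%N; lia.
by rewrite mulnA dvdn_mulr // mulnA [X in (X * _)%N]mulnC -addn2 expnD dvdn_mul.
Qed.

(** Truncation moves the computation into the polynomial ring, where the binomial theorem is
    available. *)
Lemma qseries_exp_coef (a : qseries) (m n i : nat) : (i <= n)%N ->
  qseries_exp a m i = ((\poly_(j < n.+1) a j) ^+ m)`_i.
Proof.
elim: m i => [|m IH] i in_; first by rewrite expr0 coef1.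
rewrite exprS coefM /qseries_exp iterS -/(qseries_exp a m) /qseries_mul.
apply: eq_bigr => j _; have ji := ltn_ord j.
rewrite coef_poly -IH; last lia.
by rewrite (_ : (j < n.+1)%N); last lia.
Qed.

Lemma qseries_exp_congr (p k N : nat) (a f : qseries) :
    prime p -> (2 < p)%N -> (0 < N)%N -> (p ^ k %| N)%N ->
    (forall n, f n \in coprime_den p) ->
    (forall n, a n = qseries_one n + p%:R * f n) ->
  forall n, exists2 z, z \in coprime_den p
    & qseries_exp a N n
        = qseries_one n + p%:R * N%:R * f n + (p ^ k.+2)%:R * z.
Proof.
move=> pp p2 N0 pN fp aE n; rewrite (qseries_exp_coef _ _ _ _ (leqnn n)).
pose F := \poly_(j < n.+1) f j.
have -> : \poly_(j < n.+1) a j = 1 + p%:R *: F.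
  apply/polyP => i; rewrite coefD coefZ !coef_poly coef1.
  case: ltnP => i_n; first by rewrite aE.
  by rewrite mulr0 addr0; case: i i_n.
have FX i : F ^+ i \is a polyOver (coprime_den p).
  by apply: rpredX; apply: polyOver_poly => j _; exact: fp.
case: N N0 pN => // N _ pN.
(* The witness collects the binomial terms of index i + 2; indices 0 and 1 give the two explicit
   terms. *)
exists (\sum_(i < N) (F ^+ i.+2)`_n * ('C(N.+1, i.+2) * p ^ i.+2 %/ p ^ k.+2)%:R).
  apply: rpred_sum => i _; apply: rpredM; last exact: rpred_nat.
  exact: (polyOverP (FX _)).
rewrite exprDn !big_ord_recl /= !coefD expr1n mulr1 bin0 mulr1n coef1 -addrA.
congr (_ + (_ + _)).
  by rewrite /bump /= expr1n mul1r expr1 bin1 coefMn coefZ coef_poly ltnS leqnn; ring.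
rewrite coef_sum mulr_sumr; apply: eq_bigr => i _.
rewrite /bump /= !add1n expr1n mul1r coefMn exprZn coefZ mulrCA -natrM.
rewrite [X in _ = _ * X%:R]mulnC divnK ?dvdn_bin_expn //.
by rewrite natrM natrX; ring.
Qed.

(** * Comparison of the Eisenstein series *)

(** Taking u = 1/(p B_w) exposes the factor [p] in 2w/B_w = p (2w u). *)
Lemma eisenstein_congr (p N : nat) (w := (N * p.-1)%N) :
    prime p -> (2 < p)%N -> (0 < N)%N ->
  exists u,
    [/\ u \in coprime_den p,
        exists2 y, y \in coprime_den p & u + 1 = p%:R * y
      & forall n, (0 < n)%N ->
        eisenstein w n = p%:R * (- (2 * w)%:R * u * (sigma w.-1 n)%:R)].
Proof.
move=> pp p2 N0; have w0 : (0 < w)%N by rewrite muln_gt0 N0; lia.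
have [z zp zE] := bernoulli_congr_N1 _ _ pp p2 w0 (dvdn_mull N (dvdnn _)).
have [u0 up uE] := invr_congr_N1 _ _ _ (prime_gt1 pp) zp zE.
exists (p%:R * bernoulli w)^-1; split=> // n n0.
rewrite /eisenstein gtn_eqF //.
by move: u0; rewrite mulf_eq0 negb_or => /andP[? ?]; field; apply/andP.
Qed.

Local Close Scope ring_scope.

Theorem theorem1p3 (p k r : nat) (p_prime : prime p) (p_ge5 : 5 <= p)
    (k_gt0 : 0 < k) (r_gt0 : 0 < r) :
  qseries_congr p k.+1
    (eisenstein (r * p ^ k.-1 * p.-1))
    (qseries_exp (eisenstein p.-1) (r * p ^ k.-1)).
Proof.
have p2 : 2 < p by lia.
(* After this shift N = r p^k and the modulus is p^(k+2). *)
case: k k_gt0 => // k _; rewrite succnK; set N := r * p ^ k.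
have N0 : 0 < N by rewrite muln_gt0 r_gt0 expn_gt0 prime_gt0.
have [u [up [y yp uE] Eu]] := eisenstein_congr p N p_prime p2 N0.
have [v [vp [x xp vE] Ev]] := eisenstein_congr p 1 p_prime p2 isT.
rewrite mul1n in Ev.
pose f : qseries := fun n => (if n == 0 then 0 else
  - (2 * p.-1)%:R * v * (sigma p.-1.-1 n)%:R)%R.
have fp n : f n \in coprime_den p.
  rewrite /f; case: (n == 0); first exact: rpred0.
  by rewrite !rpredM ?rpredN ?rpred_nat.
have Ef n : (eisenstein p.-1 n = qseries_one n + p%:R * f n)%R.
  rewrite /qseries_one /f; case: n => [|n]; first by rewrite mulr0 addr0.
  by rewrite Ev //= add0r.
move=> n.
have [z zp ->] := qseries_exp_congr p k N _ f p_prime p2 N0 (dvdn_mull _ (dvdnn _)) fp Ef n.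
case: n => [|n].
  exists (- z)%R; first by rewrite -coprime_den_p_integral // rpredN.
  by rewrite /f /qseries_one /eisenstein /= mulr0 addr0; ring.
have [t tp tE] := eqn_mod_rat _ _ _ (sigma_congr _ _ n.+1 p_prime p2 N0).
rewrite Eu // /f /qseries_one /= add0r.
set s' := (sigma (N * _).-1 _)%:R%R in tE *; set s := (sigma _ _)%:R%R in tE *.
(* Substituting u = p y - 1, v = p x - 1 and s' = s + p t gives u s' - v s = p (y s' - x s - t),
   while p N = r p^(k+1). *)
exists (- (2 * p.-1 * r)%:R * (y * s' - x * s - t) - z)%R.
  rewrite -coprime_den_p_integral //.
  by rewrite !(rpredB, rpredM, rpredN) ?rpred_nat.
have {}uE : u = (p%:R * y - 1)%R by rewrite -uE addrK.
have {}vE : v = (p%:R * x - 1)%R by rewrite -vE addrK.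
have {}tE : s' = (p%:R * t + s)%R by rewrite -tE subrK.
by rewrite natrX !exprS uE vE tE /N !natrM natrX; ring.
Qed.
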